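(* (i) For arbitrary parameters $a > 0$ and $b > 1$, with $\delta := (a+1)/(a+b)$, \[ \rho \bigl( \mathrm{Beta}(a,b), \mathrm{Gamma}(a,a+b) \bigr) \le (1-\delta)^{-1/2} \] and \[ d_{\mathrm{TV}} \bigl( \mathrm{Beta}(a,b), \mathrm{Gamma}(a,a+b) \bigr) \le 1 - (1-\delta)^{1/2} < \frac{\delta}{2-\delta} . \] (ii) For $a > 0$, $b > 1$ and arbitrary $c > 0$, \[ \rho \bigl( \mathrm{Beta}(a,b), \mathrm{Gamma}(a,c) \bigr) \ge \rho \bigl( \mathrm{Beta}(a,b), \mathrm{Gamma}(a,a+b-1) \bigr) . \] Moreover, with $\widetilde{\delta} := a/(a+b-1)$ (which satisfies $\widetilde{\delta} < \delta$), \[ \rho \bigl( \mathrm{Beta}(a,b), \mathrm{Gamma}(a,a+b-1) \bigr) \le (1-\widetilde{\delta})^{-1/2} \] and \[ d_{\mathrm{TV}} \bigl( \mathrm{Beta}(a,b), \mathrm{Gamma}(a,a+b-1) \bigr) \le 1 - (1-\widetilde{\delta})^{1/2} < \frac{\widetilde{\delta}}{2-\widetilde{\delta}} . \]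
   Context: $\mathrm{Beta}(a,b)$ is viewed as a distribution on $(0,\infty)$ with Lebesgue density $\beta_{a,b}(x) = \frac{\Gamma(a+b)}{\Gamma(a)\Gamma(b)} x^{a-1}(1-x)_+^{b-1}$, $x>0$. $\mathrm{Gamma}(a,c)$ is the gamma distribution with shape $a>0$ and rate $c>0$, with density $\gamma_{a,c}(x) = \frac{c^a}{\Gamma(a)} x^{a-1} e^{-cx}$, $x>0$. For probability measures $Q,P$ on $(\mathcal{X},\mathcal{A})$: $\rho(Q,P) := \sup_{A \in \mathcal{A}} Q(A)/P(A)$ with conventions $0/0 := 0$, $a/0 := \infty$ for $a>0$; $d_{\mathrm{TV}}(Q,P) := \sup_{A \in \mathcal{A}} |Q(A)-P(A)|$. *)

(* Defs.v *)
From HB Require Import structures.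
From mathcomp Require Import all_boot all_order all_algebra.
From mathcomp Require Import all_classical all_reals all_analysis.
Set Implicit Arguments. Unset Strict Implicit. Unset Printing Implicit Defensive.
Import Order.TTheory GRing.Theory Num.Theory.
Local Open Scope classical_set_scope.
Local Open Scope ring_scope.

Section defs.
Variable R : realType.
Local Notation mu := (@lebesgue_measure R).

Definition GammaF (a : R) : R :=
  fine (\int[mu]_(x in `]0%R, +oo[%classic) (x `^ (a - 1) * expR (- x))%:E)%E.

Definition beta_dens (a b : R) (x : R) : R :=
  GammaF (a + b) / (GammaF a * GammaF b) * x `^ (a - 1)
  * (Num.max (1 - x) 0) `^ (b - 1).

Definition gamma_dens (a c : R) (x : R) : R :=
  c `^ a / GammaF a * x `^ (a - 1) * expR (- (c * x)).

(* The distribution on (0,oo) with Lebesgue density f, evaluated on Borel sets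
   of R (a Borel set A of R is identified with A ∩ (0,oo)). *)
Definition dist_of (f : R -> R) (A : set R) : \bar R :=
  (\int[mu]_(x in A `&` `]0%R, +oo[%classic) (f x)%:E)%E.

Definition Beta_dist (a b : R) := dist_of (beta_dens a b).
Definition Gamma_dist (a c : R) := dist_of (gamma_dens a c).

Definition ratio (q p : \bar R) : \bar R :=
  if p == 0%E then (if q == 0%E then 0%E else +oo%E)
  else (q * p^-1)%E.

Definition rho (Q P : set R -> \bar R) : \bar R :=
  ereal_sup [set ratio (Q A) (P A) | A in [set A : set R | measurable A]].

Definition dTV (Q P : set R -> \bar R) : \bar R :=
  ereal_sup [set `|(Q A - P A)%E|%E | A in [set A : set R | measurable A]].

End defs.

(* Main.v *)
(* Two densities with f <= M g give rho <= M and, both having mass 1,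
   d_TV <= 1 - 1/M.  The ratio Beta(a,b)/Gamma(a,c) of densities is largest at
   x = 1 - (b-1)/c, and its value there is controlled by the remainder
   binet z = ln Gamma(z) + z - (z - 1/2) ln z of Stirling's formula: for c = a+b
   and for c = a+b-1, the bound (c/(b-1))^(1/2) amounts to
   binet c <= binet (b-1).  That binet decreases follows from the fact that
   binet x - binet (x+1) = (x + 1/2) ln(1 + 1/x) - 1 does, once we know that
   limsup_n (binet (x+n+t) - binet (x+n)) <= 0 for 0 <= t <= 1; the latter comes
   from Gamma(z+t) <= z^t Gamma(z), obtained by integrating Bernoulli's inequality
   for x^t.
   For the optimality of c0 = a+b-1, compare densities at the single point
   x0 = a/c0: the ratio for c0 is maximal there, and c0 maximizes the
   Gamma(a,c) density at x0 as a function of c.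
   The functional equation of Gamma and the beta integral both come from
   Gamma(a) Gamma(b) = Gamma(a+b) B(a,b) (Tonelli), the former with b = 1. *)

Require Import Defs.
From HB Require Import structures.
From mathcomp Require Import all_boot all_order all_algebra.
From mathcomp Require Import all_classical all_reals all_analysis.
From mathcomp Require Import measurable_realfun ring lra.
Import Order.TTheory GRing.Theory Num.Theory.
Import numFieldNormedType.Exports.
Local Open Scope classical_set_scope.
Local Open Scope ring_scope.

(** * Affine change of variables for Lebesgue measure *)

Section substitution.
Context {R : realType}.
Local Notation mu := (@lebesgue_measure R).

(** By uniqueness of Lebesgue measure: the scaled pushforward gives half-open intervals their
    length. *)
Lemma lebesgue_measure_affine (c d : R) (A : set R) : 0 < c ->
  measurable A ->
  mu A = (c%:E *
    pushforward mu ((fun x => (c * x + d)%R) : R -> measurableTypeR R) A)%E.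
Proof.
move=> c0 mA.
have mphi : measurable_fun setT
    ((fun x => c * x + d) : measurableTypeR R -> measurableTypeR R).
  by apply: measurable_funD => //; exact: measurable_funM.
pose cn := NngNum (ltW c0).
pose phi : {mfun measurableTypeR R >-> measurableTypeR R} :=
  HB.pack ((fun x => c * x + d) : measurableTypeR R -> measurableTypeR R)
    (isMeasurableFun.Build _ _ _ _ _ mphi).
apply: (@lebesgue_measure_unique R (mscale cn (pushforward mu phi)))
  => //= _ [[a b]] _ <-.
rewrite /mscale /= /pushforward/=.
have -> : (fun x => c * x + d) @^-1` `]a, b] = `](a - d) / c, (b - d) / c]%classic.
  by apply/seteqP; split => x /=; rewrite !in_itv/= ltr_pdivrMr// ler_pdivlMr//
    ltrBlDr lerBrDr mulrC.
rewrite !lebesgue_measure_itv/= !lte_fin ltr_pM2r ?invr_gt0// ltrD2r.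
case: ifPn => ab; last by rewrite mule0.
rewrite -!EFinD -EFinM; congr EFin; field.
by rewrite gt_eqF.
Qed.

Lemma ge0_integral_affine (f : R -> \bar R) (c d : R) : 0 < c ->
  measurable_fun setT f -> (forall x, 0 <= f x)%E ->
  (\int[mu]_x f x = c%:E * \int[mu]_x f (c * x + d)%R)%E.
Proof.
move=> c0 mf f0.
have mphi : measurable_fun setT
    ((fun x => c * x + d) : measurableTypeR R -> measurableTypeR R).
  by apply: measurable_funD => //; exact: measurable_funM.
pose cn := NngNum (ltW c0).
pose phi : {mfun measurableTypeR R >-> measurableTypeR R} :=
  HB.pack ((fun x => c * x + d) : measurableTypeR R -> measurableTypeR R)
    (isMeasurableFun.Build _ _ _ _ _ mphi).
rewrite -[X in (_ * integral _ X _)%E](@preimage_setT _ _ phi).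
rewrite -(ge0_integral_pushforward mphi)// -(ge0_integral_mscale _ _ cn)//.
by apply: eq_measure_integral => A mA _; exact: lebesgue_measure_affine.
Qed.

End substitution.

(** * The product formula linking Gamma and beta integrals *)

Section beta_gamma.
Context {R : realType}.
Local Notation mu := (@lebesgue_measure R).

(** The cut-off lets integrals over (0,oo) and (0,1) be taken over the whole line, where affine
    substitutions apply; [powR] alone does not vanish at negative bases. *)
Definition ppow (a x : R) : R := if 0 < x then x `^ (a - 1) else 0.

Lemma ppow_ge0 a x : 0 <= ppow a x.
Proof. by rewrite /ppow; case: ifP => // _; exact: powR_ge0. Qed.

Lemma measurable_ppow a : measurable_fun setT (ppow a).
Proof.
rewrite (_ : ppow a = (fun x => x `^ (a - 1) * \1_(`]0, +oo[) x)).
  by apply: measurable_funM => //; exact: measurable_powR.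
apply/funext => x; rewrite /ppow indicE.
case: ifPn => x0; first by rewrite mem_set ?mulr1//= in_itv/= x0.
by rewrite memNset ?mulr0//= in_itv/= (negbTE x0).
Qed.

Lemma ppowM a x y : 0 < x -> ppow a (x * y) = x `^ (a - 1) * ppow a y.
Proof.
move=> x0; rewrite /ppow pmulr_rgt0//; case: ifPn => y0; last by rewrite mulr0.
by rewrite powRM ?ltW.
Qed.

Lemma integral_ppow a (g : R -> R) :
  (\int[mu]_(x in `]0%R, +oo[) (x `^ (a - 1) * g x)%:E =
   \int[mu]_x (ppow a x * g x)%:E)%E.
Proof.
rewrite integral_mkcond; apply: eq_integral => x _; rewrite patchE /ppow.
by rewrite mem_setE in_itv/= andbT; case: ifP; rewrite ?mul0r.
Qed.

Definition gamma_int (a : R) : \bar R := (\int[mu]_x (ppow a x * expR (- x))%:E)%E.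
Definition beta_int (a b : R) : \bar R :=
  (\int[mu]_x (ppow a x * ppow b (1 - x))%:E)%E.

Lemma GammaFE a : GammaF a = fine (gamma_int a).
Proof. by rewrite /GammaF integral_ppow. Qed.

Lemma measurable_ppow_expR a :
  measurable_fun setT (fun x => (ppow a x * expR (- x))%:E).
Proof.
apply/measurable_EFinP; apply: measurable_funM; first exact: measurable_ppow.
by apply: measurableT_comp => //; exact: measurable_funN.
Qed.

Lemma measurable_ppow_ppow a b y :
  measurable_fun setT (fun x => (ppow a x * ppow b (y - x))%:E).
Proof.
apply/measurable_EFinP; apply: measurable_funM; first exact: measurable_ppow.
apply: measurableT_comp; first exact: measurable_ppow.
exact: measurable_funB.
Qed.

(** Tonelli for the kernel [K], with y the sum of the two Gamma variables. Working in the extended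
    reals avoids any prior finiteness claim, so finiteness of Gamma can be derived from this
    identity. *)
Lemma gamma_int_mul a b :
  (gamma_int a * gamma_int b = gamma_int (a + b) * beta_int a b)%E.
Proof.
pose K (z : R * R) := (ppow a z.1 * ppow b (z.2 - z.1) * expR (- z.2))%:E.
have K0 z : (0 <= K z)%E by rewrite lee_fin !mulr_ge0 ?ppow_ge0 ?expR_ge0.
have mK : measurable_fun setT K.
  apply/measurable_EFinP; apply: measurable_funM.
    apply: measurable_funM.
      by apply: measurableT_comp; [exact: measurable_ppow|].
    apply: measurableT_comp; first exact: measurable_ppow.
    exact: measurable_funB.
  by apply: measurableT_comp => //; exact: measurable_funN.
have mKy y : measurable_fun setT (fun x => K (x, y)).
  exact: measurableT_comp mK _.
transitivity (\int[mu]_x \int[mu]_y K (x, y))%E.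
  rewrite /gamma_int -ge0_integralZr//; last 3 first.
  - exact: measurable_ppow_expR.
  - by move=> x _; rewrite lee_fin mulr_ge0 ?ppow_ge0 ?expR_ge0.
  - by apply: integral_ge0 => x _; rewrite lee_fin mulr_ge0 ?ppow_ge0 ?expR_ge0.
  apply: eq_integral => x _.
  (* Translating the second variable by x makes y the sum of both. *)
  rewrite (@ge0_integral_affine _ _ 1 (- x))//; last 2 first.
  - exact: measurable_ppow_expR.
  - by move=> y; rewrite lee_fin mulr_ge0 ?ppow_ge0 ?expR_ge0.
  rewrite mul1e -ge0_integralZl//; last 3 first.
  - have := @measurableT_comp _ _ _ _ _ _ _ _ _ (measurable_ppow_expR b).
    apply => /=; exact: measurable_funD.
  - by move=> y _; rewrite lee_fin mulr_ge0 ?ppow_ge0 ?expR_ge0.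
  - by rewrite lee_fin mulr_ge0 ?ppow_ge0 ?expR_ge0.
  apply: eq_integral => y _; rewrite /K -EFinM mul1r/=; congr EFin.
  have -> : expR (- y) = expR (- x) * expR (- (y - x)).
    by rewrite -expRD; congr expR; ring.
  ring.
rewrite fubini_tonelli//.
rewrite /gamma_int -ge0_integralZr//; last 3 first.
- exact: measurable_ppow_expR.
- by move=> x _; rewrite lee_fin mulr_ge0 ?ppow_ge0 ?expR_ge0.
- by apply: integral_ge0 => x _; rewrite lee_fin mulr_ge0 ?ppow_ge0.
apply: eq_integral => y _.
(* For y <= 0, x and y - x cannot both be positive, so both sides vanish. *)
have [y0|y0] := ltP 0 y; last first.
  rewrite /ppow ltNge y0/= mul0r mul0e integral0_eq// => x _.
  rewrite /K/= /ppow; case: ifPn => x0; last by rewrite !mul0r.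
  by rewrite ifN ?mulr0 ?mul0r// -leNgt subr_le0 (le_trans y0)// ltW.
(* For y > 0, replacing x by y x extracts y^(a+b-1) and leaves the beta integrand. *)
rewrite (@ge0_integral_affine _ _ y 0)//.
rewrite /ppow y0 /beta_int.
rewrite -!ge0_integralZl//; last 5 first.
- exact: measurable_ppow_ppow.
- by move=> x _; rewrite lee_fin mulr_ge0 ?ppow_ge0.
- by rewrite lee_fin mulr_ge0 ?powR_ge0 ?expR_ge0.
- have maff : measurable_fun setT (fun x => y * x + 0).
    by apply: measurable_funD => //; exact: measurable_funM.
  exact: measurableT_comp (mKy y) maff.
- by rewrite lee_fin ltW.
apply: eq_integral => x _; rewrite /K/= addr0 -!EFinM; congr EFin.
rewrite (_ : y - y * x = y * (1 - x)); last by ring.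
rewrite !ppowM//.
have -> : y `^ (a + b - 1) = y * y `^ (a - 1) * y `^ (b - 1).
  rewrite -{2}(powRr1 (ltW y0)) -!powRD ?(gt_eqF y0) ?implybT//.
  by congr (_ `^ _); ring.
ring.
Qed.

End beta_gamma.

(** * Finiteness, positivity and functional equation of Gamma *)

Section gamma_function.
Context {R : realType}.
Local Notation mu := (@lebesgue_measure R).

(** The integrand may be singular at 0, so the fundamental theorem is applied on [1/(n+2), 1] and
    monotone convergence does the rest. *)
Lemma integral_powR01 (a : R) : 0 < a ->
  (\int[mu]_(x in `]0%R, 1%R]) (x `^ (a - 1))%:E = (a^-1)%:E)%E.
Proof.
move=> a0.
(* With n+2 the left endpoint is strictly below 1 even for n = 0. *)
pose F (n : nat) : set R := `[n.+2%:R^-1, 1]%classic.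
have -> : `]0, 1]%classic = \bigcup_n F n.
  apply/seteqP; split => x /=.
    rewrite in_itv/= => /andP[x0 x1].
    have [n _] := near_infty_natSinv_lt (PosNum x0).
    move=> /(_ n (leqnn n))/= nx; exists n => //=.
    rewrite /F/= in_itv/= x1 andbT (le_trans _ (ltW nx))// lef_pV2 ?posrE ?ltr0n//.
    by rewrite ler_nat.
  case=> n _; rewrite /F/= !in_itv/= => /andP[nx ->]; rewrite andbT.
  by apply: lt_le_trans nx; rewrite invr_gt0 ltr0n.
have Fn n : (\int[mu]_(x in F n) (x `^ (a - 1))%:E =
             (a^-1 - a^-1 * n.+2%:R^-1 `^ a)%:E)%E.
  have n0 : 0 < n.+2%:R^-1 :> R by rewrite invr_gt0 ltr0n.
  rewrite /F (@continuous_FTC2 _ _ (fun x => a^-1 * x `^ a))//.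
  - by rewrite powR1 mulr1 EFinB.
  - by rewrite invf_lt1 ?ltr0n// ltr1n.
  - apply: derivable_within_continuous => x; rewrite in_itv/= => /andP[nx _].
    apply: derivable_powR; rewrite in_itv/= andbT.
    exact: lt_le_trans nx.
  - have dp x : 0 < x -> derivable (fun x => a^-1 * x `^ a) x 1.
      move=> x0; apply: derivableM; first exact: derivable_cst.
      by apply: derivable_powR; rewrite in_itv/= andbT.
    have cp x : 0 < x -> {for x, continuous (fun x => a^-1 * x `^ a)}.
      by move=> x0; apply: differentiable_continuous; apply/derivable1_diffP/dp.
    split.
    + by move=> x; rewrite in_itv/= => /andP[nx _]; apply/dp/(lt_trans n0).
    + exact: cvg_at_right_filter (cp _ n0).
    + exact: cvg_at_left_filter (cp _ ltr01).
  - move=> x; rewrite in_itv/= => /andP[nx _]; have x0 := lt_trans n0 nx.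
    rewrite derive1E deriveM//; last first.
      by apply: derivable_powR; rewrite in_itv/= andbT.
    rewrite derive_cst scaler0 addr0 -derive1E powR_derive1 ?in_itv/= ?andbT//.
    by rewrite /GRing.scale/= mulrA mulVf ?mul1r// gt_eqF.
have := @ge0_nondecreasing_set_cvg_integral _ (measurableTypeR R) R F
  (fun x => (x `^ (a - 1))%:E) mu.
move=> /(_ _ _ _ _)/cvg_lim <- //; last first.
- by move=> i x _; rewrite lee_fin powR_ge0.
- by move=> i; apply/measurable_EFinP/measurable_funTS; exact: measurable_powR.
- by move=> i; exact: measurable_itv.
- move=> m n mn; apply/subsetPset => x; rewrite /F/= !in_itv/= => /andP[mx ->].
  rewrite andbT (le_trans _ mx)// lef_pV2 ?posrE ?ltr0n//.
  by rewrite ler_nat !ltnS.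
apply/cvg_lim => //; under eq_fun do rewrite Fn.
apply/cvg_EFin; first exact: nearW.
rewrite -[X in _ --> X]subr0 -[X in _ - X](mulr0 a^-1).
apply: cvgB; first exact: cvg_cst.
apply: cvgM; first exact: cvg_cst.
apply: (iffLR (cvg_at_rightP (fun x => x `^ a) 0 0) (powR_cvg0 a0)); split.
  by move=> n; rewrite invr_gt0 ltr0n.
by have := @cvg_harmonic R; rewrite -cvg_shiftS.
Qed.

Lemma beta_int1 (a : R) : 0 < a -> beta_int a 1 = (a^-1)%:E.
Proof.
move=> a0; rewrite -integral_powR01// -integral_itv_bndo_bndc; last first.
  by apply/measurable_EFinP/measurable_funTS; exact: measurable_powR.
rewrite [RHS]integral_mkcond; apply: eq_integral => x _.
rewrite patchE mem_setE in_itv/= /ppow subr_gt0 subrr powRr0.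
by case: ifP => _; rewrite ?mul0r//=; case: ifP; rewrite ?mulr1 ?mulr0.
Qed.

(** This is the total mass of the exponential distribution of rate 1. *)
Lemma gamma_int1 : gamma_int 1 = 1%E :> \bar R.
Proof.
transitivity (\int[mu]_(x in `]0%R, +oo[) (expR (- x))%:E)%E.
  rewrite [RHS]integral_mkcond; apply: eq_integral => x _.
  rewrite patchE mem_setE in_itv/= andbT /ppow subrr powRr0.
  by case: ifP; rewrite ?mul0r// mul1r.
rewrite integral_itv_obnd_cbnd; last first.
  apply/measurable_EFinP/measurable_funTS.
  by apply: measurableT_comp => //; exact: measurable_funN.
rewrite -(@integral_exponential_pdf R 1)// integral_mkcond.
apply: eq_integral => x _; rewrite /exponential_pdf !patchE.
by case: ifP => // _; rewrite mul1r mulN1r.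
Qed.

Lemma gamma_int_ge0 (a : R) : (0 <= gamma_int a)%E.
Proof.
by apply: integral_ge0 => x _; rewrite lee_fin mulr_ge0 ?ppow_ge0 ?expR_ge0.
Qed.

Lemma gamma_intS (a : R) : 0 < a -> gamma_int (a + 1) = (a%:E * gamma_int a)%E.
Proof.
move=> a0; have := gamma_int_mul a 1; rewrite gamma_int1 mule1 beta_int1// => ->.
by rewrite muleCA -EFinM divff ?mule1// gt_eqF.
Qed.

Lemma gamma_int_nat_fin n : gamma_int n.+1%:R \is a @fin_num R.
Proof.
elim: n => [|n ih]; first by rewrite gamma_int1.
by rewrite -natr1 gamma_intS ?ltr0n// fin_numM.
Qed.

(** The functional equation settles positive integers. For general a it moves the question to a + 1,
    whose integrand has the nonnegative exponent a and is dominated by the sum of those of 1 (for x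
    <= 1) and of a large integer (for x > 1). *)
Lemma gamma_int_fin (a : R) : 0 < a -> gamma_int a \is a fin_num.
Proof.
move=> a0.
have -> : gamma_int a = (a^-1%:E * gamma_int (a + 1))%E.
  by rewrite gamma_intS// muleA -EFinM mulVf ?mul1e// gt_eqF.
rewrite fin_numM// ge0_fin_numE ?gamma_int_ge0//.
pose n := Num.truncn a.
have an : a + 1 <= n.+2%:R.
  by rewrite -[leRHS]natr1 lerD2r ltW// truncnS_gt.
apply: (@le_lt_trans _ _ (gamma_int 1 + gamma_int n.+2%:R)%E); last first.
  have : (gamma_int 1 + gamma_int n.+2%:R)%E \is a @fin_num R.
    by rewrite fin_numD gamma_int1 (gamma_int_nat_fin n.+1).
  by rewrite ge0_fin_numE// adde_ge0 ?gamma_int_ge0.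
rewrite /gamma_int -ge0_integralD//; last 4 first.
- by move=> x _; rewrite lee_fin mulr_ge0 ?ppow_ge0 ?expR_ge0.
- exact: (measurable_ppow_expR _).
- by move=> x _; rewrite lee_fin mulr_ge0 ?ppow_ge0 ?expR_ge0.
- exact: (measurable_ppow_expR _).
apply: ge0_le_integral => //.
- by move=> x _; rewrite lee_fin mulr_ge0 ?ppow_ge0 ?expR_ge0.
- exact: (measurable_ppow_expR _).
- by apply: emeasurable_funD; exact: measurable_ppow_expR.
move=> x _; rewrite -EFinD lee_fin -mulrDl ler_wpM2r ?expR_ge0//.
rewrite /ppow; case: ifPn => x0; last by rewrite addr0.
have [x1|x1] := leP x 1.
  rewrite (@le_trans _ _ (x `^ (1 - 1)))//; last by rewrite lerDl powR_ge0.
  by rewrite ger_powR ?x0//; lra.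
rewrite (@le_trans _ _ (x `^ (n.+2%:R - 1)))//; last by rewrite lerDr powR_ge0.
by rewrite ler_powR ?(ltW x1)// lerD2r.
Qed.

Lemma EFin_GammaF (a : R) : 0 < a -> (GammaF a)%:E = gamma_int a.
Proof. by move=> a0; rewrite GammaFE fineK// gamma_int_fin. Qed.

(** On (0,1) the factor e^(-x) is at least e^(-1), hence Gamma(a) >= e^(-1) B(a,1) = e^(-1) / a. *)
Lemma GammaF_gt0 (a : R) : 0 < a -> 0 < GammaF a.
Proof.
move=> a0; rewrite -lte_fin EFin_GammaF//.
apply: (@lt_le_trans _ _ ((expR (- 1))%:E * beta_int a 1)%E).
  by rewrite beta_int1// -EFinM lte_fin mulr_gt0 ?expR_gt0 ?invr_gt0.
rewrite /beta_int -ge0_integralZl//; last 2 first.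
- exact: (measurable_ppow_ppow a 1 1).
- by move=> x _; rewrite lee_fin mulr_ge0 ?ppow_ge0.
apply: ge0_le_integral => //.
- by move=> x _; rewrite -EFinM lee_fin !mulr_ge0 ?ppow_ge0 ?expR_ge0.
- by apply: measurable_funeM; apply: (measurable_ppow_ppow a 1 1).
- exact: (measurable_ppow_expR _).
move=> x _; rewrite -EFinM lee_fin mulrCA ler_wpM2l ?ppow_ge0//.
rewrite {1}/ppow subr_gt0 subrr powRr0; case: ifPn => x1; last first.
  by rewrite mulr0 expR_ge0.
by rewrite mulr1 ler_expR lerN2 ltW.
Qed.

Lemma GammaFS (a : R) : 0 < a -> GammaF (a + 1) = a * GammaF a.
Proof.
move=> a0; apply: EFin_inj.
by rewrite EFinM !EFin_GammaF ?gamma_intS// addr_gt0.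
Qed.

Lemma beta_intE (a b : R) : 0 < a -> 0 < b ->
  beta_int a b = (GammaF a * GammaF b / GammaF (a + b))%:E.
Proof.
move=> a0 b0; have ab0 := addr_gt0 a0 b0.
have G0 := GammaF_gt0 _ ab0.
have -> : beta_int a b =
    ((GammaF (a + b))^-1%:E * (gamma_int (a + b) * beta_int a b))%E.
  by rewrite -EFin_GammaF// muleA -EFinM mulVf ?mul1e// gt_eqF.
by rewrite -gamma_int_mul -!EFin_GammaF// -!EFinM mulrC.
Qed.

End gamma_function.

(** * Elementary inequalities for logarithms and powers *)

Section real_inequalities.
Context {R : realType}.

Lemma ger0_is_derive_le (f df : R -> R) (a x y : R) :
  (forall z, a < z -> is_derive z 1 f (df z)) ->
  (forall z, a < z -> 0 <= df z) -> a < x -> x <= y -> f x <= f y.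
Proof.
move=> fdf df0 ax; rewrite le_eqVlt => /predU1P[->//|xy].
have [z||z] := @MVT R f df x y xy.
- by rewrite in_itv/= => /andP[xz _]; apply/fdf/(lt_trans ax).
- apply: derivable_within_continuous => z; rewrite in_itv/= => /andP[xz _].
  by have [] := fdf _ (lt_le_trans ax xz).
rewrite in_itv/= => /andP[xz _] e.
by rewrite -subr_ge0 e mulr_ge0 ?subr_ge0 ?(ltW xy)// df0// (lt_trans ax).
Qed.

Lemma ln_le_subr1 (x : R) : 0 < x -> ln x <= x - 1.
Proof.
by move=> x0; rewrite -{1}(subrKC 1 x) le_ln1Dx// ltrBrDl subrr.
Qed.

(** After multiplication by 2w the claim is f(1) <= f(w) for f(x) = x^2 - 2 x ln x, whose derivative
    2 (x - 1 - ln x) is nonnegative. *)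
Lemma ln_le_half_sub_inv (w : R) : 1 <= w -> ln w <= (w - w^-1) / 2.
Proof.
move=> w1; have w0 : 0 < w by exact: lt_le_trans w1.
pose f (x : R) := x * x - x * ln x *+ 2.
have : f 1 <= f w.
  apply: (@ger0_is_derive_le _ (fun x => (x - 1 - ln x) *+ 2) 0)
    => [z z0|z z0|//|//].
    have := is_derive1_ln z0 => dln.
    rewrite /f; apply: is_derive_eq.
    rewrite /GRing.scale/= !mulr1 mulfV ?gt_eqF//; lra.
  by rewrite mulrn_wge0// subr_ge0 ln_le_subr1.
rewrite /f ln1 mulr0 mul0rn subr0 mulr1 => fw.
rewrite ler_pdivlMr// -(ler_pM2l w0) mulrBr mulfV ?gt_eqF//.
by rewrite -subr_ge0 in fw; rewrite -subr_ge0; lra.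
Qed.

(** The sign of the derivative is [ln_le_half_sub_inv] at w = (z+1)/z, where (w - 1/w)/2 = (z + 1/2)
    (1/z - 1/(z+1)). *)
Lemma log_ratio_decreasing (x y : R) : 0 < x -> x <= y ->
  (y + 2^-1) * (ln (y + 1) - ln y) <= (x + 2^-1) * (ln (x + 1) - ln x).
Proof.
move=> x0 xy; rewrite -lerN2.
pose f (z : R) := - ((z + 2^-1) * (ln (z + 1) - ln z)).
apply: (@ger0_is_derive_le f (fun z => - (ln (z + 1) - ln z
  + (z + 2^-1) * ((z + 1)^-1 - z^-1))) 0)
  => [z z0|z z0|//|//].
  have := is_derive1_ln z0 => dln.
  have z10 : 0 < z + 1 by rewrite addr_gt0.
  have dln1 : is_derive z 1 (fun z => ln (z + 1)) ((z + 1)^-1).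
    have dS : is_derive z 1 (fun z => z + 1) 1.
      by apply: is_derive_eq; rewrite addr0.
    have := @is_derive1_comp _ (@ln R) (fun z => z + 1) z _ _
      (is_derive1_ln z10) dS.
    by rewrite mulr1.
  rewrite /f; apply: is_derive_eq.
  rewrite /GRing.scale/=; ring.
have z10 : 0 < z + 1 by rewrite addr_gt0.
rewrite oppr_ge0 -ln_div ?posrE//.
have := @ln_le_half_sub_inv ((z + 1) / z) _.
rewrite ler_pdivlMr// mul1r lerDl => /(_ ler01).
rewrite invf_div.
have -> : ((z + 1) / z - z / (z + 1)) / 2 = - (z + 2^-1) * ((z + 1)^-1 - z^-1).
  by field; rewrite !gt_eqF.
lra.
Qed.

(** The graph of the concave function x^t lies below its tangent at z. With u = x/z this reads t ln
    u <= ln w, where w = 1 - t + t u. *)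
Lemma powR_le_tangent (t x z : R) : 0 <= t <= 1 -> 0 < x -> 0 < z ->
  x `^ t <= z `^ t * (1 - t + t * (x / z)).
Proof.
move=> /andP[t0 t1] x0 z0.
have u0 : 0 < x / z by rewrite divr_gt0.
have -> : x `^ t = z `^ t * (x / z) `^ t.
  by rewrite -powRM ?ltW// mulrC divfK// gt_eqF.
rewrite ler_pM2l ?powR_gt0//.
set u := x / z in u0 *; set w := 1 - t + t * u.
have w0 : 0 < w.
  rewrite /w; have [t1'|t1'] := ltP t 1.
    by apply: ltr_wpDr; rewrite ?subr_gt0// mulr_ge0// ltW.
  have -> : t = 1 by apply/eqP; rewrite eq_le t1.
  by rewrite subrr add0r mul1r.
rewrite /powR gt_eqF// -[leRHS](lnK w0) ler_expR.
have h1 : ln u - ln w <= u / w - 1.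
  by rewrite -ln_div ?posrE// ln_le_subr1// divr_gt0.
have h2 : - ln w <= w^-1 - 1.
  by rewrite -lnV ?posrE// ln_le_subr1// invr_gt0.
(* Weighting [h1] by t and [h2] by 1 - t makes the right-hand sides cancel, by the choice of w. *)
have e : t * (u / w - 1) + (1 - t) * (w^-1 - 1) = 0.
  by rewrite /w; field; rewrite gt_eqF.
have := lerD (ler_wpM2l t0 h1) (ler_wpM2l (_ : 0 <= 1 - t) h2).
rewrite subr_ge0 => /(_ t1); rewrite e; lra.
Qed.

End real_inequalities.

(** * Monotonicity of the Stirling remainder *)

Section stirling.
Context {R : realType}.
Local Notation mu := (@lebesgue_measure R).

(** The tangent to x^t is taken at x = z: since Gamma(z+1) = z Gamma(z), its two terms then
    integrate to (1-t) and t times z^t Gamma(z). *)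
Lemma GammaF_le_powR (z t : R) : 0 < z -> 0 <= t <= 1 ->
  GammaF (z + t) <= z `^ t * GammaF z.
Proof.
move=> z0 t01; have /andP[t0 t1] := t01.
pose c1 := z `^ t * (1 - t); pose c2 := z `^ t * t / z.
have c10 : 0 <= c1 by rewrite mulr_ge0 ?powR_ge0 ?subr_ge0.
have c20 : 0 <= c2 by rewrite divr_ge0 ?(ltW z0)// mulr_ge0 ?powR_ge0.
have zt0 : 0 < z + t by rewrite ltr_wpDr.
have z10 : 0 < z + 1 by rewrite addr_gt0.
have -> : z `^ t * GammaF z = c1 * GammaF z + c2 * GammaF (z + 1).
  by rewrite GammaFS// /c1 /c2; field; rewrite gt_eqF.
suff : (gamma_int (z + t) <= c1%:E * gamma_int z + c2%:E * gamma_int (z + 1))%E.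
  by rewrite -!EFin_GammaF// -!EFinM -EFinD lee_fin.
have f0 a x : (0 <= (ppow a x * expR (- x) : R)%:E)%E.
  by rewrite lee_fin mulr_ge0 ?ppow_ge0 ?expR_ge0.
rewrite /gamma_int -!ge0_integralZl//; last 2 first.
- exact: measurable_ppow_expR.
- exact: measurable_ppow_expR.
have mc c a : measurable_fun setT
    (fun x : R => c%:E * (ppow a x * expR (- x))%:E)%E.
  by apply: measurable_funeM; exact: measurable_ppow_expR.
have fc0 c a x : 0 <= c -> (0 <= c%:E * (ppow a x * expR (- x) : R)%:E)%E.
  by move=> c0; rewrite mule_ge0.
rewrite -ge0_integralD//; last 4 first.
- by move=> x _; apply: fc0.
- exact: mc.
- by move=> x _; apply: fc0.
- exact: mc.
apply: ge0_le_integral => //.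
- exact: measurable_ppow_expR.
- by apply: emeasurable_funD; exact: mc.
move=> x _; rewrite -!EFinM -EFinD lee_fin !mulrA -mulrDl ler_wpM2r ?expR_ge0//.
rewrite /ppow; case: ifPn => x0; last by rewrite !mulr0 addr0.
have xp r : x `^ (z + r - 1) = x `^ (z - 1) * x `^ r.
  by rewrite -powRD ?(gt_eqF x0) ?implybT//; congr (_ `^ _); ring.
rewrite !xp powRr1 ?(ltW x0)//.
have := ler_wpM2l (powR_ge0 x (z - 1)) (powR_le_tangent _ _ _ t01 x0 z0).
move=> /le_trans; apply; rewrite le_eqVlt; apply/predU1P; left.
by rewrite /c1 /c2; field; rewrite gt_eqF.
Qed.

Definition binet (z : R) := ln (GammaF z) + z - (z - 2^-1) * ln z.

Lemma binet_subS (x : R) : 0 < x ->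
  binet x - binet (x + 1) = (x + 2^-1) * (ln (x + 1) - ln x) - 1.
Proof.
move=> x0; rewrite /binet GammaFS// lnM ?posrE ?GammaF_gt0//; lra.
Qed.

(** Each unit shift enlarges the increment, because [binet] loses at least as much from x+n to x+n+1
    as from x+n+t to x+n+t+1. *)
Lemma binet_subD (x t : R) n : 0 < x -> 0 <= t ->
  binet (x + t) - binet x <= binet (x + n%:R + t) - binet (x + n%:R).
Proof.
move=> x0 t0; elim: n => [|n]; first by rewrite addr0.
move=> /le_trans; apply.
have xn0 : 0 < x + n%:R by rewrite ltr_wpDr.
have xnt0 : 0 < x + n%:R + t by rewrite ltr_wpDr.
have := binet_subS _ xn0; have := binet_subS _ xnt0.
have := @log_ratio_decreasing R (x + n%:R) (x + n%:R + t) xn0.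
rewrite lerDl t0 => /(_ isT).
rewrite -[n.+1%:R]natr1 addrA (addrAC (x + n%:R) t 1); lra.
Qed.

(** Inserting the bound on Gamma(z+t) leaves t + (z+t-1/2) (ln z - ln(z+t)). As the coefficient is
    nonnegative, ln u <= u - 1 bounds this by t / (2(z+t)). *)
Lemma binet_subD_le (z t : R) : 2^-1 <= z -> 0 <= t <= 1 ->
  binet (z + t) - binet z <= z^-1.
Proof.
move=> hz /andP[t0 t1].
have z0 : 0 < z by apply: lt_le_trans hz; rewrite invr_gt0.
have zt0 : 0 < z + t by rewrite ltr_wpDr.
have hG : ln (GammaF (z + t)) <= t * ln z + ln (GammaF z).
  rewrite -ln_powR -lnM ?posrE ?powR_gt0 ?GammaF_gt0//.
  by rewrite ler_ln ?posrE ?mulr_gt0 ?powR_gt0 ?GammaF_gt0// GammaF_le_powR// t0.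
have hl : ln z - ln (z + t) <= z / (z + t) - 1.
  by rewrite -ln_div ?posrE// ln_le_subr1// divr_gt0.
have zt2 : 0 <= z + t - 2^-1 by rewrite subr_ge0 (le_trans hz)// lerDl.
have := ler_wpM2l zt2 hl; rewrite /binet.
have -> : (z + t - 2^-1) * (z / (z + t) - 1) = - t + t / (2 * (z + t)).
  by field; rewrite gt_eqF.
have : t / (2 * (z + t)) <= z^-1.
  rewrite ler_pdivrMr ?mulr_gt0// mulrC ler_pdivlMr//.
  have : t * z <= z by rewrite ler_piMl// ltW.
  clear -t0 z0; lra.
move: hG; move: (t / _) z^-1 (ln z) (ln (z + t)) => q v L M.
move: (ln (GammaF (z + t))) (ln (GammaF z)) => G1 G0; clear; lra.
Qed.

(** A positive increment at x would persist at every x + n, where it is at most 1/(x+n) once x + n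
    >= 1/2. *)
Lemma binet_addr_le (x t : R) : 0 < x -> 0 <= t <= 1 -> binet (x + t) <= binet x.
Proof.
move=> x0 /[dup] t01 /andP[t0 t1]; rewrite leNgt; apply/negP => lt.
have d0 : 0 < binet (x + t) - binet x by rewrite subr_gt0.
have [n _] := near_infty_natSinv_lt (PosNum d0).
move=> /(_ n (leqnn n)); rewrite /= ltNge => /negP; apply.
apply: (le_trans (binet_subD _ _ n.+1 x0 t0)).
have n1 : 1 <= n.+1%:R :> R by rewrite ler1n.
apply: le_trans (binet_subD_le _ _ _ t01) _; first by lra.
by rewrite lef_pV2 ?posrE ?lerDr ?ltW// ltr_wpDr.
Qed.

Lemma binet_decreasing (x y : R) : 0 < x -> x <= y -> binet y <= binet x.
Proof.
move=> x0 xy.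
have [m] : exists m : nat, y <= x + m%:R.
  by exists (Num.truncn (y - x)).+1; rewrite addrC -lerBlDr ltW// truncnS_gt.
elim: m x x0 xy => [|n ih] x x0 xy.
  by rewrite addr0 => yx; have -> : x = y by apply/eqP; rewrite eq_le xy.
rewrite -nat1r addrA => yn.
have [y1|y1] := leP y (x + 1).
  by rewrite -(subrKC x y) binet_addr_le// subr_ge0 xy lerBlDl.
rewrite (le_trans (ih _ _ (ltW y1) yn))// ?addr_gt0//.
by rewrite binet_addr_le// ler01 lexx.
Qed.

End stirling.

(** * From pointwise density bounds to [rho] and [dTV], and back *)

Section density_ratio.
Context {R : realType}.
Local Notation mu := (@lebesgue_measure R).
Implicit Types (f g : R -> R) (A : set R).

Lemma dist_of_ge0 f A : (forall x, 0 <= f x) -> (0 <= dist_of f A)%E.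
Proof. by move=> f0; apply: integral_ge0 => x _; rewrite lee_fin. Qed.

Lemma dist_ofC f A : (forall x, 0 <= f x) -> measurable_fun setT f ->
  measurable A -> (dist_of f A + dist_of f (~` A) = dist_of f setT)%E.
Proof.
move=> f0 mf mA; rewrite /dist_of -ge0_integral_setU//.
- by rewrite -setIUl setUv.
- exact: measurableI.
- by apply: measurableI => //; exact: measurableC.
- exact/measurable_EFinP/measurable_funTS.
- by move=> x _; rewrite lee_fin.
- by apply/disj_set2P; rewrite setIACA setICr set0I.
Qed.

Lemma dist_of_fin f A : (forall x, 0 <= f x) -> measurable_fun setT f ->
  measurable A -> dist_of f setT = 1%E ->
  (dist_of f A \is a fin_num) &&
  (fine (dist_of f A) + fine (dist_of f (~` A)) == 1).
Proof.
move=> f0 mf mA f1; have := dist_ofC _ _ f0 mf mA; rewrite f1.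
have := dist_of_ge0 _ A f0; have := dist_of_ge0 _ (~` A) f0.
case: (dist_of f A) => [p||]; case: (dist_of f (~` A)) => [q||]//= _ _.
by rewrite -EFinD => -[->].
Qed.

Lemma le_dist_of f g (M : R) A : (forall x, 0 <= f x) -> (forall x, 0 <= g x) ->
  measurable_fun setT f -> measurable_fun setT g -> 0 <= M ->
  (forall x, 0 < x -> f x <= M * g x) -> measurable A ->
  (dist_of f A <= M%:E * dist_of g A)%E.
Proof.
move=> f0 g0 mf mg M0 fg mA; rewrite /dist_of.
have mAP : measurable (A `&` `]0, +oo[) by exact: measurableI.
rewrite -ge0_integralZl_EFin//; last 2 first.
- by move=> x _; rewrite lee_fin.
- exact/measurable_EFinP/measurable_funTS.
apply: ge0_le_integral => //.
- by move=> x _; rewrite lee_fin.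
- exact/measurable_EFinP/measurable_funTS.
- by apply: measurable_funeM; exact/measurable_EFinP/measurable_funTS.
- by move=> x /= [_]; rewrite in_itv/= andbT => x0; rewrite -EFinM lee_fin fg.
Qed.

(** The conventions 0/0 = 0 and a/0 = oo are exactly what keeps this equivalence true at p = 0. *)
Lemma ratio_le (q p : \bar R) (M : R) : (0 <= q)%E -> (0 <= p)%E -> 0 <= M ->
  p \is a fin_num -> (Defs.ratio q p <= M%:E)%E = (q <= M%:E * p)%E.
Proof.
move=> q0 + M0; case: p => [p||]//; rewrite lee_fin /Defs.ratio eqe => p0 _.
have [->|pn0] := eqVneq p 0.
  rewrite mule0; case: ifPn => [/eqP ->|qn0]; first by rewrite lee_fin M0 lexx.
  by rewrite leye_eq/=; apply/esym/negbTE; rewrite eq_le q0 andbT in qn0.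
by rewrite inver (negbTE pn0) lee_pdivrMr// lt_neqAle eq_sym pn0.
Qed.

Lemma rho_le f g (M : R) : (forall x, 0 <= f x) -> (forall x, 0 <= g x) ->
  measurable_fun setT f -> measurable_fun setT g -> 0 <= M ->
  dist_of g setT = 1%E ->
  (rho (dist_of f) (dist_of g) <= M%:E)%E <->
  (forall A, measurable A -> (dist_of f A <= M%:E * dist_of g A)%E).
Proof.
move=> f0 g0 mf mg M0 g1.
have gfin A : measurable A -> dist_of g A \is a fin_num.
  by move=> mA; have /andP[] := dist_of_fin _ _ g0 mg mA g1.
split => [rM A mA|fgM].
  rewrite -ratio_le ?dist_of_ge0 ?gfin//; apply: le_trans rM.
  by apply: ereal_sup_ubound; exists A.
apply: ge_ereal_sup => _ [A mA <-].
by rewrite ratio_le ?dist_of_ge0 ?gfin ?fgM.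
Qed.

Lemma rho_ge0 f g : (0 <= rho (dist_of f) (dist_of g))%E.
Proof.
apply: ereal_sup_ubound; exists set0; first exact: measurable0.
by rewrite /Defs.ratio /dist_of set0I !integral_set0 eqxx.
Qed.

(** From Q(A) <= M P(A) follows Q(A) - P(A) <= (1 - 1/M) Q(A) <= 1 - 1/M; the complement of A gives
    the opposite sign. *)
Lemma dTV_le f g (M : R) : (forall x, 0 <= f x) -> (forall x, 0 <= g x) ->
  measurable_fun setT f -> measurable_fun setT g -> 0 < M ->
  dist_of f setT = 1%E -> dist_of g setT = 1%E ->
  (forall x, 0 < x -> f x <= M * g x) ->
  (dTV (dist_of f) (dist_of g) <= (1 - M^-1)%:E)%E.
Proof.
move=> f0 g0 mf mg M0 f1 g1 fg.
have fgM A : measurable A -> (dist_of f A <= M%:E * dist_of g A)%E.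
  by move=> mA; apply: le_dist_of => //; exact: ltW.
(* Compare the total masses. *)
have M1 : 1 <= M.
  by have := fgM _ (measurableT); rewrite f1 g1 mule1 lee_fin.
have key A : measurable A ->
    fine (dist_of f A) - fine (dist_of g A) <= 1 - M^-1.
  move=> mA; have mAC := measurableC mA.
  have /andP[ff /eqP fs] := dist_of_fin _ _ f0 mf mA f1.
  have /andP[gf _] := dist_of_fin _ _ g0 mg mA g1.
  have h0 : 0 <= fine (dist_of f (~` A)) by rewrite fine_ge0// dist_of_ge0.
  have := fgM _ mA.
  rewrite -(fineK ff) -(fineK gf) -EFinM lee_fin/=.
  set q := fine (dist_of f A) in fs *; set p := fine (dist_of g A).
  rewrite mulrC -ler_pdivrMr// => qp.
  have q1 : q <= 1 by lra.
  have i0 : 0 <= 1 - M^-1 by rewrite subr_ge0 invf_le1.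
  have := ler_wpM2r i0 q1; lra.
apply: ge_ereal_sup => _ [A mA <-]; have mAC := measurableC mA.
have := key _ mA; have := key _ mAC.
have /andP[ff /eqP fs] := dist_of_fin _ _ f0 mf mA f1.
have /andP[gf /eqP gs] := dist_of_fin _ _ g0 mg mA g1.
rewrite -(fineK ff) -(fineK gf) -EFinB abse_EFin lee_fin/= ler_norml.
move=> h1 h2; apply/andP; split; lra.
Qed.

(** If f(x) > K g(x), continuity gives f >= K g + eta on an interval A around x, and then Q(A) >= K
    P(A) + eta |A| > K P(A). *)
Lemma density_le_rho f g (K x : R) : (forall x, 0 <= f x) -> (forall x, 0 <= g x) ->
  measurable_fun setT f -> measurable_fun setT g ->
  dist_of g setT = 1%E -> 0 <= K ->
  (rho (dist_of f) (dist_of g) <= K%:E)%E ->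
  0 < x -> {for x, continuous f} -> {for x, continuous g} -> f x <= K * g x.
Proof.
move=> f0 g0 mf mg g1 K0 /rho_le fgK x0 cf cg; rewrite leNgt; apply/negP => gf.
pose eta := (f x - K * g x) / 2.
have eta0 : 0 < eta by rewrite divr_gt0// subr_gt0.
have ch : (f y - K * g y) @[y --> x] --> f x - K * g x.
  by apply: cvgB => //; apply: cvgM => //; exact: cvg_cst.
have etah : eta < f x - K * g x by rewrite /eta ltr_pdivrMr//; lra.
(* The radius also keeps the interval inside (0,oo), so [dist_of] integrates over all of it. *)
have [e /= e0 eP] : exists2 e : R, 0 < e & forall y, `|x - y| < e ->
    0 < y /\ K * g y + eta <= f y.
  have : \forall y \near x, 0 < y /\ K * g y + eta <= f y.
    near=> y; split; first by near: y; exact: lt_nbhsr.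
    have : eta < f y - K * g y by near: y; exact: cvgr_gt etah.
    lra.
  by move=> /nbhs_ballP[e /= e0 eP]; exists e.
pose A : set R := `]x - e, x + e[%classic.
have mA : measurable A by exact: measurable_itv.
have AP y : A y -> 0 < y /\ K * g y + eta <= f y.
  rewrite /A/= in_itv/= => /andP[y1 y2]; apply: eP.
  by rewrite ltr_norml; apply/andP; split; lra.
have AI : A `&` `]0, +oo[ = A.
  by apply/setIidl => y /AP[y0 _]; rewrite /= in_itv/= y0.
have := fgK f0 g0 mf mg K0 g1 A mA; apply/negP; rewrite -ltNge.
have gfin : dist_of g A \is a fin_num.
  by have /andP[] := dist_of_fin _ _ g0 mg mA g1.
apply: (@lt_le_trans _ _ (K%:E * dist_of g A + eta%:E * mu A)%E).
  rewrite lteDl ?fin_numM// /A lebesgue_measure_itv/= lte_fin.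
  have -> : x - e < x + e by lra.
  by rewrite -EFinD -EFinM lte_fin mulr_gt0//; lra.
rewrite /dist_of AI -integral_cst// -ge0_integralZl_EFin//; last 2 first.
- by move=> y _; rewrite lee_fin.
- exact/measurable_EFinP/measurable_funTS.
have mKg : measurable_fun A (fun y => K%:E * (g y)%:E)%E.
  by apply: measurable_funeM; exact/measurable_EFinP/measurable_funTS.
rewrite -ge0_integralD//; last 2 first.
- by move=> y _; rewrite mule_ge0 ?lee_fin.
- by move=> y _; rewrite lee_fin ltW.
apply: ge0_le_integral => //.
- by move=> y _; rewrite adde_ge0 ?mule_ge0 ?lee_fin// ltW.
- exact: emeasurable_funD.
- exact/measurable_EFinP/measurable_funTS.
- by move=> y /AP[_]; rewrite -EFinM -EFinD lee_fin.
Unshelve. all: by end_near. Qed.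

End density_ratio.

(** * Beta and Gamma densities and the maximum of their ratio *)

Section beta_gamma_densities.
Context {R : realType}.
Local Notation mu := (@lebesgue_measure R).
Implicit Types a b c x : R.
Local Opaque GammaF.

Lemma beta_dens_ge0 a b x : 0 < a -> 0 < b -> 0 <= beta_dens a b x.
Proof.
move=> a0 b0; rewrite /beta_dens !mulr_ge0 ?powR_ge0 ?invr_ge0 ?mulr_ge0//;
  by rewrite ltW// GammaF_gt0// addr_gt0.
Qed.

Lemma gamma_dens_ge0 a c x : 0 < a -> 0 <= gamma_dens a c x.
Proof.
move=> a0; rewrite /gamma_dens !mulr_ge0 ?powR_ge0 ?expR_ge0 ?invr_ge0//.
by rewrite ltW// GammaF_gt0.
Qed.

Lemma measurable_beta_dens a b : measurable_fun setT (beta_dens a b).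
Proof.
apply: measurable_funM.
  by apply: measurable_funM => //; exact: measurable_powR.
apply: (measurableT_comp (measurable_powR _)).
by apply: measurable_maxr => //; exact: measurable_funB.
Qed.

Lemma measurable_gamma_dens a c : measurable_fun setT (gamma_dens a c).
Proof.
apply: measurable_funM.
  by apply: measurable_funM => //; exact: measurable_powR.
by apply: measurableT_comp => //; apply: measurable_funN; exact: measurable_funM.
Qed.

Lemma Beta_distT a b : 0 < a -> 1 < b -> Beta_dist a b setT = 1%E.
Proof.
move=> a0 b1; have b0 : 0 < b by exact: lt_trans b1.
pose k := GammaF (a + b) / (GammaF a * GammaF b).
rewrite /Beta_dist /dist_of setTI.
transitivity (\int[mu]_(x in `]0%R, +oo[)
  (x `^ (a - 1) * (k * ppow b (1 - x)))%:E)%E.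
  apply: eq_integral => x _; rewrite /beta_dens -/k; congr EFin.
  rewrite /ppow subr_gt0; case: ifPn => [x1|].
    by rewrite max_l ?subr_ge0 ?ltW//; ring.
  (* For x >= 1 the density is 0 because the exponent b - 1 is nonzero; 0^0 would be 1. *)
  rewrite -leNgt => x1; rewrite max_r ?subr_le0// powR0 ?mulr0//.
  by rewrite gt_eqF// subr_gt0.
rewrite integral_ppow.
have k0 : 0 < k.
  by rewrite /k divr_gt0// ?mulr_gt0// ?GammaF_gt0// addr_gt0.
under eq_integral do rewrite mulrCA EFinM.
rewrite ge0_integralZl_EFin//; last 3 first.
- by move=> x _; rewrite lee_fin mulr_ge0 ?ppow_ge0.
- exact: (measurable_ppow_ppow a b 1).
- exact: ltW.
rewrite -/(beta_int a b) beta_intE// -EFinM /k; congr EFin.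
move: (GammaF_gt0 _ a0) (GammaF_gt0 _ b0) (GammaF_gt0 _ (addr_gt0 a0 b0)).
move: (GammaF a) (GammaF b) (GammaF (a + b)) => A B C A0 B0 C0.
by field; rewrite (gt_eqF A0) (gt_eqF B0) (gt_eqF C0).
Qed.

Lemma Gamma_distT a c : 0 < a -> 0 < c -> Gamma_dist a c setT = 1%E.
Proof.
move=> a0 c0; have G0 := GammaF_gt0 _ a0.
rewrite /Gamma_dist /dist_of setTI.
transitivity (\int[mu]_(x in `]0%R, +oo[)
  (x `^ (a - 1) * (c `^ a / GammaF a * expR (- (c * x))))%:E)%E.
  by apply: eq_integral => x _; rewrite /gamma_dens; congr EFin; ring.
rewrite integral_ppow.
have : gamma_int a = (GammaF a)%:E by rewrite EFin_GammaF.
rewrite {1}/gamma_int (@ge0_integral_affine _ _ c 0)//; last 2 first.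
- exact: measurable_ppow_expR.
- by move=> x; rewrite lee_fin mulr_ge0 ?ppow_ge0 ?expR_ge0.
move=> GE.
have mcE : measurable_fun setT
    (fun x => (ppow a (c * x + 0) * expR (- (c * x + 0)))%:E).
  have maff : measurable_fun setT (fun x : R => c * x + 0).
    by apply: measurable_funD => //; exact: measurable_funM.
  exact: measurableT_comp (measurable_ppow_expR a) maff.
transitivity ((GammaF a)^-1%:E * (c%:E * \int[mu]_x
    (ppow a (c * x + 0) * expR (- (c * x + 0)))%:E))%E; last first.
  by rewrite GE -EFinM mulVf// gt_eqF.
rewrite muleA -EFinM.
rewrite -ge0_integralZl_EFin; [|exact: measurableT| |exact: mcE|]; last 2 first.
- by move=> x _; rewrite lee_fin mulr_ge0 ?ppow_ge0 ?expR_ge0.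
- by rewrite mulr_ge0 ?invr_ge0// ltW.
apply: eq_integral => x _; rewrite addr0 -EFinM; congr EFin.
rewrite ppowM// -(mulr_powRB1 (ltW c0) a0); field.
by rewrite gt_eqF.
Qed.

(** In exponential form, comparisons of densities become linear in the logarithms. *)
Lemma beta_densE a b x : 0 < a -> 0 < b -> 0 < x < 1 ->
  beta_dens a b x = expR (ln (GammaF (a + b)) - ln (GammaF a) - ln (GammaF b)
                          + (a - 1) * ln x + (b - 1) * ln (1 - x)).
Proof.
move=> a0 b0 /andP[x0 x1].
have y0 : 0 < 1 - x by rewrite subr_gt0.
rewrite /beta_dens (max_l (ltW y0)) /powR (gt_eqF x0) (gt_eqF y0).
move: (GammaF_gt0 _ a0) (GammaF_gt0 _ b0) (GammaF_gt0 _ (addr_gt0 a0 b0)).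
move: (GammaF a) (GammaF b) (GammaF (a + b)) => A B C A0 B0 C0.
by rewrite !expRD !expRN !lnK ?posrE// invfM mulrA.
Qed.

Lemma gamma_densE a c x : 0 < a -> 0 < c -> 0 < x ->
  gamma_dens a c x = expR (a * ln c - ln (GammaF a) + (a - 1) * ln x - c * x).
Proof.
move=> a0 c0 x0.
rewrite /gamma_dens /powR (gt_eqF x0) (gt_eqF c0).
move: (GammaF a) (GammaF_gt0 _ a0) => A A0.
by rewrite !expRD !expRN lnK.
Qed.

(* The logarithm of [beta_dens a b x / gamma_dens a c x] at its critical point
   [x = 1 - (b - 1) / c]. *)
Definition log_ratio a b c : R :=
  ln (GammaF (a + b)) - ln (GammaF b) + (b - 1) * ln (b - 1) + (c - b + 1)
  - (a + b - 1) * ln c.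

(** For x < 1 this is b - 1 times ln u <= u - 1 at u = (1-x) c / (b-1), where u = 1 is the critical
    point. That point need not lie in (0,1). *)
Lemma beta_dens_le a b c x : 0 < a -> 1 < b -> 0 < c -> 0 < x ->
  beta_dens a b x <= expR (log_ratio a b c) * gamma_dens a c x.
Proof.
move=> a0 b1 c0 x0; have b0 : 0 < b by exact: lt_trans b1.
have d0 : 0 < b - 1 by rewrite subr_gt0.
have [x1|x1] := ltP x 1; last first.
  rewrite /beta_dens max_r ?subr_le0// powR0 ?gt_eqF// mulr0.
  by rewrite mulr_ge0 ?expR_ge0 ?gamma_dens_ge0.
rewrite beta_densE ?x0// gamma_densE// -expRD ler_expR /log_ratio.
have y0 : 0 < 1 - x by rewrite subr_gt0.
have : ln ((1 - x) * c / (b - 1)) <= (1 - x) * c / (b - 1) - 1.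
  by rewrite ln_le_subr1// divr_gt0// mulr_gt0.
rewrite ln_div ?posrE ?mulr_gt0// lnM ?posrE// => /(ler_wpM2l (ltW d0)).
rewrite [leRHS](_ : _ = (1 - x) * c - (b - 1)); last first.
  by field; rewrite gt_eqF.
move: (ln (GammaF (a + b))) (ln (GammaF a)) (ln (GammaF b)) => A B C.
move: (ln x) (ln (1 - x)) (ln c) (ln (b - 1)) => X Y Z W; clear; lra.
Qed.

(** For this c the critical point 1 - (b-1)/c equals a/c and lies in (0,1), so the bound is
    attained. *)
Lemma beta_dens_eq a b (c := a + b - 1) : 0 < a -> 1 < b ->
  beta_dens a b (a / c) = expR (log_ratio a b c) * gamma_dens a c (a / c).
Proof.
move=> a0 b1; have b0 : 0 < b by exact: lt_trans b1.
have d0 : 0 < b - 1 by rewrite subr_gt0.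
have c0 : 0 < c by rewrite /c -addrA addr_gt0.
have ac0 : 0 < a / c by rewrite divr_gt0.
have y : 1 - a / c = (b - 1) / c by rewrite /c; field; rewrite gt_eqF.
rewrite beta_densE//; last first.
  by rewrite ac0 ltr_pdivrMr// mul1r /c; lra.
rewrite gamma_densE// -expRD /log_ratio y (ln_div d0 c0).
rewrite (_ : c * (a / c) = a); last by field; rewrite gt_eqF.
congr expR; move: (ln (GammaF _)) (ln (GammaF a)) (ln (GammaF b)) => A B C.
move: (ln (a / c)) (ln c) (ln (b - 1)) => X Y Z; rewrite /c; ring.
Qed.

(** As a function of the rate c', the log-density at a/c is a ln c' - c' a/c up to a constant, with
    maximum at c' = c. *)
Lemma gamma_dens_le a c c' : 0 < a -> 0 < c -> 0 < c' ->
  gamma_dens a c' (a / c) <= gamma_dens a c (a / c).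
Proof.
move=> a0 c0 c'0; have ac0 : 0 < a / c by rewrite divr_gt0.
rewrite !gamma_densE// ler_expR.
have : ln (c' / c) <= c' / c - 1 by rewrite ln_le_subr1// divr_gt0.
rewrite ln_div ?posrE// => /(ler_wpM2l (ltW a0)).
rewrite (mulrCA c) mulfV ?gt_eqF// (mulrCA c' a c^-1); lra.
Qed.

Lemma continuous_powR r x : 0 < x -> {for x, continuous (fun x => x `^ r)}.
Proof.
move=> x0; apply: differentiable_continuous; apply/derivable1_diffP.
by apply: derivable_powR; rewrite in_itv/= andbT.
Qed.

Lemma continuous_beta_dens a b x : 0 < x < 1 -> {for x, continuous (beta_dens a b)}.
Proof.
move=> /andP[x0 x1]; apply: cvgM.
  by apply: cvgM; [exact: cvg_cst|exact: continuous_powR].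
apply: (@continuous_comp _ _ _ (fun x => Num.max (1 - x) 0)
  (fun y => y `^ (b - 1))).
  apply: (@continuous_max _ _ (fun x => 1 - x) (fun=> 0)); last exact: cvg_cst.
  by apply: cvgB; [exact: cvg_cst|exact: cvg_id].
by apply: continuous_powR; rewrite lt_max subr_gt0 x1.
Qed.

Lemma continuous_gamma_dens a c x : 0 < x -> {for x, continuous (gamma_dens a c)}.
Proof.
move=> x0; apply: cvgM.
  by apply: cvgM; [exact: cvg_cst|exact: continuous_powR].
apply: (@continuous_comp _ _ _ (fun x => - (c * x)) expR);
  last exact: continuous_expR.
by apply: cvgN; apply: cvgM; [exact: cvg_cst|exact: cvg_id].
Qed.

Lemma log_ratio_le a b c : 0 < a -> 1 < b -> c = a + b \/ c = a + b - 1 ->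
  expR (log_ratio a b c) <= ((b - 1) / c) `^ (- 2^-1).
Proof.
move=> a0 b1 cE; have d0 : 0 < b - 1 by rewrite subr_gt0.
have dc : b - 1 <= c by case: cE => ->; lra.
have c0 : 0 < c by exact: lt_le_trans dc.
have Gb : ln (GammaF b) = ln (b - 1) + ln (GammaF (b - 1)).
  by rewrite -{1}(subrK 1 b) GammaFS// lnM ?posrE ?GammaF_gt0.
(* Both choices of c give the same form: for c = a+b-1, the factor c in Gamma(c+1) = c Gamma(c)
   offsets the larger coefficient of ln c. *)
have GE : ln (GammaF (a + b)) + c - (a + b - 1) * ln c = binet c + 2^-1 * ln c.
  rewrite /binet; case: cE => ->.
    by move: (ln (GammaF (a + b))) (ln (a + b)) => G L; clear; lra.
  have {1}-> : a + b = (a + b - 1) + 1 by rewrite subrK.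
  have c0' : 0 < a + b - 1 by rewrite -addrA addr_gt0.
  rewrite (GammaFS _ c0') (lnM c0' (GammaF_gt0 _ c0')).
  by move: (ln (GammaF _)) (ln _) => G L; clear; lra.
rewrite /powR gt_eqF ?divr_gt0// ler_expR (ln_div d0 c0).
(* By now [log_ratio a b c] is [binet c - binet (b - 1)] plus (ln c - ln(b-1))/2, and the last term
   is the logarithm of the bound. *)
have := binet_decreasing _ _ d0 dc; move: GE.
rewrite /log_ratio Gb [binet (b - 1)]/binet.
move: (ln (GammaF (a + b))) (ln (GammaF (b - 1))) (ln c) (ln (b - 1)) (binet c).
move=> G1 G0 Lc L B; clear; lra.
Qed.

End beta_gamma_densities.

(** * The bounds on [rho] and [dTV], and the optimal rate *)

Section beta_gamma_bounds.
Context {R : realType}.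
Implicit Types a b c : R.

Lemma rho_dTV_le a b c : 0 < a -> 1 < b -> c = a + b \/ c = a + b - 1 ->
  (rho (Beta_dist a b) (Gamma_dist a c) <= (((b - 1) / c) `^ (- 2^-1))%:E)%E /\
  (dTV (Beta_dist a b) (Gamma_dist a c) <= (1 - ((b - 1) / c) `^ (2^-1))%:E)%E.
Proof.
move=> a0 b1 cE; have b0 : 0 < b by exact: lt_trans b1.
have d0 : 0 < b - 1 by rewrite subr_gt0.
have c0 : 0 < c.
  by case: cE => ->; rewrite -?addrA addr_gt0.
pose M := ((b - 1) / c) `^ (- 2^-1).
have M0 : 0 < M by rewrite powR_gt0// divr_gt0.
have fM x : 0 < x -> beta_dens a b x <= M * gamma_dens a c x.
  move=> x0; apply: le_trans (beta_dens_le _ _ _ _ a0 b1 c0 x0) _.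
  by rewrite ler_wpM2r ?gamma_dens_ge0// log_ratio_le.
have f0 x : 0 <= beta_dens a b x by exact: beta_dens_ge0.
have g0 x : 0 <= gamma_dens a c x by exact: gamma_dens_ge0.
have mf := measurable_beta_dens a b; have mg := measurable_gamma_dens a c.
split.
  apply/rho_le => //; [exact: ltW|exact: Gamma_distT|move=> A mA].
  by apply: le_dist_of => //; exact: ltW.
rewrite -[(_ / _) `^ 2^-1]invrK -powRN.
by apply: dTV_le => //; [exact: Beta_distT|exact: Gamma_distT].
Qed.

Lemma rho_min a b c : 0 < a -> 1 < b -> 0 < c ->
  (rho (Beta_dist a b) (Gamma_dist a (a + b - 1)) <=
   rho (Beta_dist a b) (Gamma_dist a c))%E.
Proof.
move=> a0 b1 c0; have b0 : 0 < b by exact: lt_trans b1.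
have d0 : 0 < b - 1 by rewrite subr_gt0.
pose c' := a + b - 1; have c'0 : 0 < c' by rewrite /c' -addrA addr_gt0.
have f0 x : 0 <= beta_dens a b x by exact: beta_dens_ge0.
have g0 d x : 0 <= gamma_dens a d x by exact: gamma_dens_ge0.
have mf := measurable_beta_dens a b; have mg := measurable_gamma_dens a.
have x0 : 0 < a / c' by rewrite divr_gt0.
have x1 : a / c' < 1 by rewrite ltr_pdivrMr// mul1r /c'; lra.
apply: (@le_trans _ _ (expR (log_ratio a b c'))%:E).
  apply/rho_le => //; [exact: Gamma_distT|move=> A mA].
  by apply: le_dist_of => // x; exact: beta_dens_le.
have := rho_ge0 (beta_dens a b) (gamma_dens a c).
rewrite -/(Beta_dist a b) -/(Gamma_dist a c).
(* Only a finite value r needs an argument. *)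
case E : (rho _ _) => [r||]//; last by move=> _; rewrite leey.
rewrite !lee_fin => r0.
have : beta_dens a b (a / c') <= r * gamma_dens a c (a / c').
  apply: (@density_le_rho _ (beta_dens a b) (gamma_dens a c)) => //.
  - exact: Gamma_distT.
  - by move: E; rewrite /Beta_dist /Gamma_dist => ->.
  - by apply: continuous_beta_dens; rewrite x0.
  - exact: continuous_gamma_dens.
(* At a/c' the beta density is at most r times the Gamma density of rate c, hence at most r times
   that of rate c', which is then cancelled. *)
move=> /le_trans /(_ (ler_wpM2l r0 (gamma_dens_le _ _ _ a0 c'0 c0))).
rewrite beta_dens_eq// ler_pM2r//.
by rewrite gamma_densE// expR_gt0.
Qed.

(** With s = sqrt(1-d), clearing the denominator 2 - d = 1 + s^2 leaves s (1-s)^2 > 0. *)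
Lemma one_sub_sqrt_lt (d : R) : 0 < d < 1 -> 1 - (1 - d) `^ (2^-1) < d / (2 - d).
Proof.
move=> /andP[d0 d1]; have e0 : 0 < 1 - d by rewrite subr_gt0.
rewrite powR12_sqrt ?ltW//; set s := Num.sqrt _.
have s0 : 0 < s by rewrite sqrtr_gt0.
have ss : s * s = 1 - d by rewrite -expr2 sqr_sqrtr// ltW.
have dE : d = 1 - s * s by rewrite ss; ring.
have s1 : s < 1.
  by rewrite ltNge; apply/negP => s1; have := ler_pM ler01 ler01 s1 s1; lra.
rewrite ltr_pdivlMr; last by lra.
rewrite dE -subr_gt0.
have -> : 1 - s * s - (1 - s) * (2 - (1 - s * s)) = s * ((1 - s) * (1 - s)) by ring.
by rewrite !mulr_gt0 ?subr_gt0.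
Qed.

End beta_gamma_bounds.

Theorem theorem4 (R : realType) (a b : R) (ha : 0 < a) (hb : 1 < b) :
  (let delta := (a + 1) / (a + b) in
   (rho (Beta_dist a b) (Gamma_dist a (a + b)) <= ((1 - delta) `^ (- 2^-1))%:E)%E /\
   (dTV (Beta_dist a b) (Gamma_dist a (a + b)) <= (1 - (1 - delta) `^ (2^-1))%:E)%E /\
   1 - (1 - delta) `^ (2^-1) < delta / (2 - delta))
  /\
  ((forall c : R, 0 < c ->
      (rho (Beta_dist a b) (Gamma_dist a (a + b - 1))
       <= rho (Beta_dist a b) (Gamma_dist a c))%E) /\
   (let delta := (a + 1) / (a + b) in
    let delta' := a / (a + b - 1) in
    delta' < delta /\
    (rho (Beta_dist a b) (Gamma_dist a (a + b - 1)) <= ((1 - delta') `^ (- 2^-1))%:E)%E /\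
    (dTV (Beta_dist a b) (Gamma_dist a (a + b - 1)) <= (1 - (1 - delta') `^ (2^-1))%:E)%E /\
    1 - (1 - delta') `^ (2^-1) < delta' / (2 - delta'))).
Proof.
have d0 : 0 < b - 1 by rewrite subr_gt0.
have b0 : 0 < b by exact: lt_trans hb.
have ab0 : 0 < a + b by rewrite addr_gt0.
have c0 : 0 < a + b - 1 by rewrite -addrA addr_gt0.
have e1 : 1 - (a + 1) / (a + b) = (b - 1) / (a + b) by field; rewrite gt_eqF.
have e2 : 1 - a / (a + b - 1) = (b - 1) / (a + b - 1) by field; rewrite gt_eqF.
split=> /=.
  rewrite e1; have [? ?] := rho_dTV_le _ _ _ ha hb (or_introl erefl).
  split=> //; split=> //; rewrite -e1 one_sub_sqrt_lt//.
  by rewrite divr_gt0 ?addr_gt0//= ltr_pdivrMr// mul1r ltrD2l.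
split; first by move=> c; exact: rho_min.
rewrite e2; have [? ?] := rho_dTV_le _ _ _ ha hb (or_intror erefl).
(* After cross-multiplication the two sides differ by b - 1 > 0. *)
split; first by rewrite ltr_pdivrMr// mulrAC ltr_pdivlMr//; nra.
split=> //; split=> //; rewrite -e2 one_sub_sqrt_lt//.
by rewrite divr_gt0//= ltr_pdivrMr// mul1r -addrA ltrDl.
Qed.
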